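(* Let $Q$ be a quiver constructed from a triangulation of an unpunctured surface. Then there exists a companion basis ${\bf u}$ for $Q$ such that for any (finite) mutation sequence $\mu$ the Gram matrix of the vectors $\mu({\bf u})$ is a positive semi-definite quasi-Cartan companion for $\mu(Q)$.
   Context: A quiver $Q$ with vertices $1,\dots,n$ is identified with an integer skew-symmetric $n\times n$ matrix $B=(b_{ij})$: if $b_{ij}>0$ there are $b_{ij}$ arrows from $i$ to $j$. The mutation $\mu_k(Q)$ is the quiver of $B'=(b'_{ij})$ with $b'_{ij}=-b_{ij}$ if $i=k$ or $j=k$, and $b'_{ij}=b_{ij}+\frac12(|b_{ik}|b_{kj}+b_{ik}|b_{kj}|)$ otherwise. An unpunctured surface is a compact connected oriented surface with $b\ge 1$ boundary components and a finite set of marked points, all on the boundary, with at least one marked point on every boundary component; it is assumed to admit a triangulation with at least one interior arc. A triangulation is a maximal collection of pairwise non-crossing, pairwise non-isotopic simple arcs with endpoints at marked points (not contractible and not isotopic to boundary segments); it cuts the surface into triangles. Its quiver has the arcs (interior edges) as vertices; each triangle contributes one arrow between every two of its sides that are arcs, the arrows inside a triangle being directed counter-clockwise; pairs of opposite arrows cancel. A quasi-Cartan companion of $Q$ is a symmetric $n\times n$ matrix $A=(a_{ij})$ with $a_{ii}=2$ and $|a_{ij}|=|b_{ij}|$ for $i\ne j$. A companion basis for $Q$ is a basis ${\bf u}=(u_1,\dots,u_n)$ of a real vector space with a symmetric bilinear form $\langle\cdot,\cdot\rangle$ whose Gram matrix $(\langle u_i,u_j\rangle)$ is a quasi-Cartan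 companion of $Q$. Mutation of vectors: for a pair $(Q,{\bf u})$, $\mu_k({\bf u})=(u'_1,\dots,u'_n)$ with $u'_k=-u_k$; $u'_i=u_i-\langle u_i,u_k\rangle u_k$ if $b_{ik}>0$; and $u'_i=u_i$ otherwise. For a mutation sequence $\mu=\mu_{k_m}\cdots\mu_{k_1}$, quiver and vectors are mutated simultaneously, step by step: at each step $\mu_{k_j}$ uses the current quiver. *)

(* Defs.v *)
From HB Require Import structures.
From mathcomp Require Import all_boot all_order all_algebra.

Set Implicit Arguments.
Unset Strict Implicit.
Unset Printing Implicit Defensive.

Import Order.TTheory GRing.Theory Num.Theory.
Local Open Scope ring_scope.

(** * Triangulated unpunctured surfaces

  A triangulation cuts the surface into oriented triangles, and the surface is
  recovered from these triangles by gluing, compatibly with the orientations,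
  the pairs of sides that come from the same arc.  A triangulated surface is
  recorded here by this gluing: a finite set [tri] of triangles and, for each
  side of each triangle, the arc it lies on ([Some i]) or the information that
  it is a boundary segment ([None]).  The arcs are numbered by ['I_n].

  The pair [(t, k)] stands both for the [k]-th side of [t], the sides being
  listed counter-clockwise, and for the corner of [t] where that side starts
  when the boundary of [t] is followed counter-clockwise. *)

Definition next_side (T : Type) (s : T * 'I_3) : T * 'I_3 :=
  (s.1, ordS s.2).

Section Gluing.

Variables (n : nat) (T : finType) (arc_of : T * 'I_3 -> option 'I_n).

Implicit Types (s c d : T * 'I_3) (t : T).

Definition on_boundary s : bool := arc_of s == None.

Definition glued s s' : bool :=
  [&& s != s', ~~ on_boundary s & arc_of s == arc_of s'].

Definition adjacent t t' : bool :=
  [exists k, exists k', glued (t, k) (t', k')].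

(* Glued sides are traversed in opposite directions by the two triangles, so
   the start of either one is identified with the end of the other. *)
Definition corner_glued c d : bool :=
  [exists s, exists s', glued s s' &&
     (((c == s) && (d == next_side s')) || ((c == next_side s) && (d == s')))].

Definition same_marked_point c d : bool := connect corner_glued c d.

(* The two sides incident to the corner [c] are [c], which starts there, and
   the side [s] with [next_side s = c], which ends there. *)
Definition corner_on_boundary c : bool :=
  [exists s, (c == next_side s) && (on_boundary s || on_boundary c)].

End Gluing.

(* The marked points of the glued surface are the classes of corners for
   [same_marked_point], and its boundary is the union of the boundary segments,
   so [marked_on_boundary] says that all marked points are on the boundary; it
   rules out punctures, self-folded triangles and surfaces without boundary.
   In such a gluing the arcs are automatically non-contractible, pairwise
   non-isotopic and not isotopic to boundary segments (Euler characteristic of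
   a triangulated monogon or digon), and they form a maximal collection since
   they leave only triangles. *)
Record triangulation (n : nat) := Triangulation {
  tri : finType;
  arc_of : tri * 'I_3 -> option 'I_n;
  has_arc : (0 < n)%N;
  arc_two_sides : forall i : 'I_n, #|[set s | arc_of s == Some i]| = 2;
  surface_connected : forall t t' : tri, connect (adjacent arc_of) t t';
  marked_on_boundary : forall c : tri * 'I_3,
    exists2 d, same_marked_point arc_of c d & corner_on_boundary arc_of d
}.

(** * Quivers and their mutations *)

(* Arrows [i -> j] before cancellation: one for every triangle side on [i]
   whose counter-clockwise successor in the same triangle is on [j]. *)
Definition arrows n (T : triangulation n) (i j : 'I_n) : nat :=
  #|[set s : tri T * 'I_3 |
      (arc_of s == Some i) && (arc_of (next_side s) == Some j)]|.

Definition quiver_of n (T : triangulation n) : 'M[int]_n :=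
  \matrix_(i, j) ((arrows T i j)%:Z - (arrows T j i)%:Z).

Lemma quiver_of_skew n (T : triangulation n) :
  (quiver_of T)^T = - quiver_of T.
Proof. by apply/matrixP=> i j; rewrite !mxE opprB. Qed.

(* The division by 2 is exact: [a * `|b| + `|a| * b] is [0] or [2 a b] up to
   sign. *)
Definition mutate_quiver n (k : 'I_n) (B : 'M[int]_n) : 'M[int]_n :=
  \matrix_(i, j)
    if (i == k) || (j == k) then - B i j
    else B i j + ((`|B i k| * B k j + B i k * `|B k j|) %/ 2)%Z.

(** * Companion bases *)

Section Companion.

Variables (R : realFieldType) (n : nat).

Definition quasi_Cartan_companion (B : 'M[int]_n) (A : 'M[R]_n) : Prop :=
  [/\ A^T = A,
      forall i, A i i = 2
    & forall i j, i != j -> `|A i j| = `|B i j|%:~R].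

Definition pos_semidef (A : 'M[R]_n) : Prop :=
  forall x : 'rV[R]_n, 0 <= (x *m A *m x^T) 0 0.

Variables (V : vectType R) (form : {symmetric V}).

Definition gram (u : n.-tuple V) : 'M[R]_n :=
  \matrix_(i, j) form (tnth u i) (tnth u j).

Definition companion_basis (B : 'M[int]_n) (u : n.-tuple V) : Prop :=
  basis_of fullv u /\ quasi_Cartan_companion B (gram u).

Definition mutate_vectors (k : 'I_n) (B : 'M[int]_n) (u : n.-tuple V) :
    n.-tuple V :=
  [tuple if i == k then - tnth u k
         else if 0 < B i k then
           tnth u i - form (tnth u i) (tnth u k) *: tnth u k
         else tnth u i
   | i < n].

Definition mutate_pair (p : 'M[int]_n * n.-tuple V) (k : 'I_n) :
    'M[int]_n * n.-tuple V :=
  (mutate_quiver k p.1, mutate_vectors k p.1 p.2).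

(* [ks] lists the directions in the order in which they are applied. *)
Definition mutate_seq (ks : seq 'I_n) (p : 'M[int]_n * n.-tuple V) :
    'M[int]_n * n.-tuple V :=
  foldl mutate_pair p ks.

End Companion.

(* Main.v *)
Require Import Defs.
From HB Require Import structures.
From mathcomp Require Import all_boot all_order all_algebra.
From mathcomp Require Import reals.
From mathcomp Require Import perm sesquilinear ring.

(** Cut the surface into its triangles and give each triangle [t] a unit vector
  [e_t], these vectors being orthonormal.  An arc lies on two triangles [t] and
  [t'], and the companion basis is made of vectors whose images are the
  differences [+-(e_t - e_t')]: its Gram matrix is computed by the oriented
  incidence matrix [D] of the dual graph of the triangulation.  There are
  in general more arcs than triangles, so the basis lives in [R^n] and only its
  image under [D] consists of such differences; the form is the dot product
  pulled back along [D], which makes every Gram matrix positive semi-definite.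

  Two arcs have a nonzero product exactly when they share a triangle, and the
  product of the images of two arcs sharing one triangle is [+-1], as in the
  quiver.  When they share two triangles, the product is [+-2], so the two
  arrows must not cancel.  Arrows cancel when some interior point is the end of
  these two arcs only, and an arc is twice on one triangle when some interior
  point is the end of this arc only; both are ruled out because all marked
  points are on the boundary ([dot_dual_edges]).

  Mutating at [k] amounts to flipping the arc [k].  On the combinatorial side,
  the flip moves the four other sides of the quadrilateral around by a cyclic
  permutation ([flip_side]); it keeps the surface unpunctured
  ([flip_unpunctured]) and mutates the quiver ([flip_quiver]).  On the side of
  vectors, the image of [u_k] is [+-(e_t - e_t')], so the reflection in [u_k]
  exchanges [e_t] and [e_t'].  It is applied to the arcs with an arrow to [k],
  that is, to two opposite sides of the quadrilateral, and these are precisely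
  the sides that the flip moves from one of the two triangles to the other
  ([flip_dual_edges]).  So after any sequence of mutations the vectors are again
  dual edges of a triangulation of the current quiver. *)

Set Implicit Arguments.
Unset Strict Implicit.
Unset Printing Implicit Defensive.

Import Order.TTheory GRing.Theory Num.Theory.
Local Open Scope ring_scope.

(** * Sides of triangles *)

Section Sides.

Variable T : finType.
Implicit Types x y s : T * 'I_3.
Local Notation N := (@next_side T).

Lemma next_side3 x : N (N (N x)) = x.
Proof.
case: x => t k; congr (_, _); apply: val_inj => /=.
by case: k => [[|[|[|k]]]].
Qed.

Lemma next_side_neq x : N x != x.
Proof.
case: x => t k; rewrite xpair_eqE negb_and -val_eqE; apply/orP; right.
by case: k => [[|[|[|k]]]].
Qed.

Lemma next_side_inj : injective N.
Proof. exact: (can_inj (g := N \o N) next_side3). Qed.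

Lemma next_side2_neq x : N (N x) != x.
Proof.
by rewrite -(inj_eq next_side_inj) next_side3 eq_sym next_side_neq.
Qed.

Lemma same_triangleP x y :
  (x.1 == y.1) = [|| y == x, y == N x | y == N (N x)].
Proof.
apply/idP/idP => [|/or3P[]/eqP-> //].
case: x y => t k [t' l] /= /eqP<-; rewrite !xpair_eqE !eqxx -!val_eqE /=.
by case: k l => [[|[|[|k]]]] // ? [[|[|[|l]]]].
Qed.

Lemma sum_triangle (F : T * 'I_3 -> int) x :
  \sum_(y | y.1 == x.1) F y = F x + F (N x) + F (N (N x)).
Proof.
rewrite (bigD1 x) //= (bigD1 (N x)) /= ?next_side_neq ?eqxx //.
rewrite (bigD1 (N (N x))) /=; last first.
  by rewrite eqxx next_side2_neq (inj_eq next_side_inj) next_side_neq.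
rewrite big1 ?addr0 ?addrA // => y /andP[/andP[/andP[]]].
by rewrite eq_sym same_triangleP => /or3P[]/eqP->; rewrite !eqxx.
Qed.

End Sides.

(** * Unpunctured gluings *)

Section Surface.

Variables (n : nat) (T : finType).
Implicit Types (arc : T * 'I_3 -> option 'I_n) (x y s c : T * 'I_3).
Implicit Types X : {set T * 'I_3}.
Local Notation N := (@next_side T).

Definition two_sides arc :=
  forall i : 'I_n, #|[set s | arc s == Some i]| = 2.

(** Turning around a marked point goes from the corner [c] across the side that
  starts there; if [c'] is the other copy of that side, the next corner is
  where [c'] ends. A nonempty set of corners within which one can turn forever
  contains all the corners around some interior point. So the condition below
  says that there is no such point, and unlike the existence of a boundary
  segment at every point it can be used on one- and two-element sets and pulled
  back along a flip. *)
Definition turns_within arc X :=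
  forall c, c \in X -> exists2 c', glued arc c c' & N c' \in X.

Definition unpunctured arc := forall X, turns_within arc X -> X = set0.

Section Gluing.

Variable arc : T * 'I_3 -> option 'I_n.
Hypotheses (arc2 : two_sides arc) (arcU : unpunctured arc).

Lemma glued_sym x y : glued arc x y = glued arc y x.
Proof.
rewrite /glued eq_sym; case: eqP => //= _; rewrite /on_boundary.
rewrite [arc x == arc y]eq_sym.
by case: (arc y =P arc x) => [->|]; rewrite ?andbF.
Qed.

Lemma glued_arc x y : glued arc x y -> arc x = arc y.
Proof. by case/and3P=> _ _ /eqP. Qed.

Lemma gluedI x y i : x != y -> arc x = Some i -> arc y = Some i ->
  glued arc x y.
Proof. by rewrite /glued /on_boundary => -> -> ->; rewrite eqxx. Qed.

Lemma arc_sides i :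
  exists x y, [/\ glued arc x y, arc x = Some i & arc y = Some i].
Proof.
have /eqP/cards2P[x [y [neq_xy def]]] := arc2 i.
have [] : x \in [set s | arc s == Some i] /\ y \in [set s | arc s == Some i].
  by rewrite def !inE !eqxx orbT.
rewrite !inE => /eqP ax /eqP ay; exists x, y; split=> //.
exact: gluedI ax ay.
Qed.

Lemma glued_side x y z i : glued arc x y -> arc x = Some i ->
  (arc z == Some i) = (z == x) || (z == y).
Proof.
move=> gxy ax; have ay := glued_arc gxy; rewrite ax in ay.
have /andP[neq_xy _] := gxy.
have sub : [set x; y] \subset [set s | arc s == Some i].
  by apply/subsetP=> s; rewrite !inE => /orP[]/eqP->; rewrite ?ax -?ay eqxx.
have /eqP def : [set x; y] == [set s | arc s == Some i].
  by rewrite eqEcard sub cards2 neq_xy arc2.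
by have := congr1 (fun A : {set T * 'I_3} => z \in A) def; rewrite !inE => ->.
Qed.

Lemma glued_uniq x y z : glued arc x y -> glued arc x z -> y = z.
Proof.
move=> gxy gxz; case ax: (arc x) => [i|]; last first.
  by move: gxy; rewrite /glued /on_boundary ax andbF.
have := glued_side z gxy ax; rewrite -(glued_arc gxz) ax eqxx.
have /andP[/negPf neq _] := gxz.
by rewrite eq_sym neq /= => /esym/eqP.
Qed.

(** Otherwise the corner between the two glued sides would be the only one
  around its marked point. *)
Lemma next_side_arc x i : arc x = Some i -> arc (N x) = Some i -> False.
Proof.
move=> ax aNx; have := next_side_neq x; rewrite eq_sym => neq.
have g : glued arc (N x) x by rewrite glued_sym; apply: gluedI ax aNx.
have /arcU/setP/(_ (N x)) : turns_within arc [set N x].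
  by move=> c /set1P->; exists x; rewrite ?inE.
by rewrite !inE eqxx.
Qed.

Lemma glued_triangle x y : glued arc x y -> x.1 != y.1.
Proof.
move=> g; have /and3P[neq] := g; rewrite /on_boundary.
case ax: (arc x) => [i|] // _ /eqP/esym ay.
rewrite same_triangleP eq_sym (negPf neq) /=.
apply/negP=> /orP[]/eqP def.
  by case: (next_side_arc ax); rewrite -def.
by case: (next_side_arc ay); rewrite def next_side3.
Qed.

(** Otherwise the end of [x], which is the start of [y], would be an interior
  point with only two corners, and the arrows between the arcs of [x] and [N x]
  would cancel. *)
Lemma consecutive_arcs x y i : glued arc x y ->
  arc (N x) = Some i -> arc (N (N y)) = Some i -> False.
Proof.
move=> g aNx aNNy.
have neq : N x != N (N y).
  by apply: contra (glued_triangle g) => /eqP def; rewrite -[x.1]/((N x).1) def.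
have g' := gluedI neq aNx aNNy.
have /arcU/setP/(_ y) : turns_within arc [set N x; y].
  move=> c; rewrite !inE => /orP[]/eqP->.
    by exists (N (N y)) => //; rewrite next_side3 !inE eqxx orbT.
  by exists x; rewrite 1?glued_sym // !inE eqxx.
by rewrite !inE eqxx orbT.
Qed.

End Gluing.

End Surface.

(** Where it is defined, turning around a point is injective. On a finite set
  that it maps to itself it is therefore bijective, so the set contains with a
  corner all the corners of the same marked point. One of these is on the
  boundary, where turning is impossible in one of the two directions. *)
Lemma triangulation_unpunctured n (T : triangulation n) :
  unpunctured (@arc_of n T).
Proof.
move=> X turnX; apply/setP=> c0; rewrite inE; apply/negP=> Xc0.
have arc2 := @arc_two_sides n T.
pose rho c := next_side (odflt c [pick c' | glued (@arc_of n T) c c']).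
have rhoE c c' : glued (@arc_of n T) c c' -> rho c = next_side c'.
  move=> g; rewrite /rho; case: pickP => [c1 g1|/(_ c')]; last by rewrite g.
  by rewrite (glued_uniq arc2 g g1).
have rhoX c : c \in X -> rho c \in X.
  by move=> /turnX[c' g Xc']; rewrite (rhoE _ _ g).
have rho_inj : {in X &, injective rho}.
  move=> c d /turnX[c' gc _] /turnX[d' gd _].
  rewrite (rhoE _ _ gc) (rhoE _ _ gd) => /next_side_inj def.
  by apply: (glued_uniq arc2 (x := c')); rewrite glued_sym // def.
(* Hence every corner of [X] is also reached by turning within [X]. *)
have imX : rho @: X = X.
  apply/eqP; rewrite eqEcard card_in_imset // leqnn andbT.
  by apply/subsetP=> _ /imsetP[c Xc ->]; apply: rhoX.
have invX c c' : glued (@arc_of n T) c c' -> next_side c' \in X -> c \in X.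
  move=> g; rewrite -{1}imX => /imsetP[d Xd].
  have [d' gd _] := turnX _ Xd.
  rewrite (rhoE _ _ gd) => /next_side_inj def.
  suff -> : c = d by [].
  by apply: (glued_uniq arc2 (x := c')); rewrite glued_sym // def.
have closedX c d : corner_glued (@arc_of n T) c d -> c \in X -> d \in X.
  case/existsP=> s /existsP[s' /andP[g /orP[]/andP[/eqP-> /eqP->]]].
    by move=> /turnX[s1 g1]; rewrite (glued_uniq arc2 g g1).
  by move: g; rewrite glued_sym => /invX; apply.
have [d /connectP[p path_p ->]] := marked_on_boundary c0.
have {path_p} : last c0 p \in X.
  elim: p c0 Xc0 path_p => //= d' p IHp c Xc /andP[/closedX/(_ Xc)].
  exact: IHp.
move=> Xd /existsP[s /andP[/eqP def]].
have [d' /and3P[_ /negPf-> _] _] := turnX _ Xd; rewrite orbF.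
move: Xd; rewrite def -imX => /imsetP[d1 /turnX[d2 g _]].
rewrite (rhoE _ _ g) => /next_side_inj->.
by rewrite glued_sym in g; case/and3P: g => _ /negPf->.
Qed.

(** * Flips *)

Section Flip.

Variables (n : nat) (T : finType) (arc : T * 'I_3 -> option 'I_n).
Implicit Types x y c : T * 'I_3.
Local Notation N := (@next_side T).

(** The triangles of [s] and [s'] form the quadrilateral with sides
  [N s, N (N s), N s', N (N s')] in counter-clockwise order and diagonal [s].
  The flipped diagonal gets the slots [s] and [s'], and [flip_side s s' x] is
  the old side that is put in the slot [x]: the triangle of [s] is now made of
  the diagonal, [N (N s')] and [N s], and the triangle of [s'] of the diagonal,
  [N (N s)] and [N s']. Two sides change triangles, [N (N s)] and [N (N s')].
  *)
Definition flip_side (s s' : T * 'I_3) : {perm T * 'I_3} :=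
  (tperm (N s) (N (N s')) * tperm (N s) (N s') * tperm (N s) (N (N s)))%g.

Definition flip s s' (x : T * 'I_3) := arc (flip_side s s' x).

Variables s s' : T * 'I_3.
Hypothesis neq_tri : s.1 != s'.1.

Lemma neq_sides x y : x.1 = s.1 -> y.1 = s'.1 -> (x == y) = false.
Proof.
by move=> xs ys; apply: contraNF neq_tri => /eqP def; rewrite -xs def ys.
Qed.

Lemma flip_sideE :
  [/\ flip_side s s' (N s) = N (N s'), flip_side s s' (N (N s)) = N s,
      flip_side s s' (N s') = N (N s), flip_side s s' (N (N s')) = N s'
    & forall x, x \notin [:: N s; N (N s); N s'; N (N s')] ->
        flip_side s s' x = x].
Proof.
have n12 (x : T * 'I_3) : N x != N (N x).
  by rewrite eq_sym next_side_neq.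
have d k l (x := iter k N s) (y := iter l N s') : (x != y).
  by rewrite /x /y neq_sides //; [elim: k {x} | elim: l {y}].
have d11 := d 1 1; have d12 := d 1 2; have d21 := d 2 1; have d22 := d 2 2.
rewrite /= in d11 d12 d21 d22.
rewrite /flip_side; split=> [||||x].
- by rewrite !permM tpermL [tperm _ (N s') _]tpermD // tpermD.
- rewrite !permM [tperm (N s) (N (N s')) _]tpermD //; last by rewrite eq_sym.
  by rewrite [tperm (N s) (N s') _]tpermD ?tpermR // eq_sym.
- rewrite !permM [tperm (N s) (N (N s')) _]tpermD //; last by rewrite eq_sym.
  by rewrite tpermR tpermL.
- by rewrite !permM tpermR tpermL tpermD // eq_sym.
rewrite !inE !negb_or ![x == _]eq_sym => /and4P[n1 n2 n3 n4].
by rewrite !permM !(tpermD n1).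
Qed.

Lemma flip_side_tri x : x.1 != s.1 -> x.1 != s'.1 -> flip_side s s' x = x.
Proof.
move=> ns ns'; have [_ _ _ _ -> //] := flip_sideE.
by rewrite !inE; apply/or4P => -[]/eqP def; move: ns ns'; rewrite def /= eqxx.
Qed.

Lemma flip_side_diag : flip_side s s' s = s /\ flip_side s s' s' = s'.
Proof.
have [_ _ _ _ E] := flip_sideE.
have n1 x : x == N x = false by rewrite eq_sym (negPf (next_side_neq x)).
have n2 x : x == N (N x) = false by rewrite eq_sym (negPf (next_side2_neq x)).
split; rewrite E // !inE n1 n2 /=.
  by rewrite (@neq_sides s (N s')) // (@neq_sides s (N (N s'))).
rewrite eq_sym (@neq_sides (N s) s') // orbF.
by rewrite eq_sym (@neq_sides (N (N s)) s').
Qed.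

Lemma side_cases x :
  (x.1 != s.1 /\ x.1 != s'.1) \/
  [\/ x = s, x = N s | x = N (N s)] \/
  [\/ x = s', x = N s' | x = N (N s')].
Proof.
have [def|neq] := eqVneq x.1 s.1.
  move/eqP: def; rewrite eq_sym same_triangleP => /or3P[]/eqP->; right; left.
  - exact: Or31.
  - exact: Or32.
  - exact: Or33.
have [def|neq'] := eqVneq x.1 s'.1; last by left.
move/eqP: def; rewrite eq_sym same_triangleP => /or3P[]/eqP->; right; right.
- exact: Or31.
- exact: Or32.
- exact: Or33.
Qed.

Hypotheses (arc2 : two_sides arc) (arcU : unpunctured arc).
Hypothesis gs : glued arc s s'.

Lemma glued_flip x y :
  glued (flip s s') x y = glued arc (flip_side s s' x) (flip_side s s' y).
Proof. by rewrite /glued (inj_eq perm_inj). Qed.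

Lemma flip_two_sides : two_sides (flip s s').
Proof.
move=> i; rewrite -(arc2 i).
rewrite -[RHS](card_preimset _ (@perm_inj _ (flip_side s s'))).
by apply: eq_card => x; rewrite !inE.
Qed.

(** Let [X] be a set of corners within which one can turn after the flip. The
  corners of the new triangulation are translated to those of the old one at
  the same marked point. A slot other than [s] and [s'] translates by
  [flip_side]. The ends of the old diagonal have one more corner before the
  flip, which accounts for the last two clauses of [Y], while the corners [s]
  and [s'], one at each end of the new diagonal, are dropped: turning from them
  leads to a corner of [X] where a side of the quadrilateral starts. *)
Lemma flip_unpunctured : unpunctured (flip s s').
Proof.
have [F1 F2 F3 F4 _] := flip_sideE; have [F0 F0'] := flip_side_diag.
have gflip : glued (flip s s') s s' by rewrite glued_flip F0 F0'.
move=> X turnX.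
have next_glued c c' : glued (flip s s') c c' -> c \in X -> N c' \in X.
  by move=> g /turnX[c1 g1]; rewrite (glued_uniq flip_two_sides g g1).
have Xs := next_glued _ _ gflip.
have Xs' : s' \in X -> N s \in X by apply: next_glued; rewrite glued_sym.
pose Y := [set c | [|| (c \notin [:: s; s']) &&
    (c \in flip_side s s' @: X), (c == s') && (N (N s) \in X)
    | (c == s) && (N (N s') \in X)]].
have diag c : (flip_side s s' c \in [:: s; s']) = (c \in [:: s; s']).
  have inj := inj_eq (@perm_inj _ (flip_side s s')) c.
  by rewrite !inE -(inj s) -(inj s') F0 F0'.
have YI c : c \in X -> c \notin [:: s; s'] -> flip_side s s' c \in Y.
  by move=> Xc nc; rewrite inE diag nc imset_f.
have n1 x : N x == x = false := negPf (next_side_neq x).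
have n2 x : N (N x) == x = false := negPf (next_side2_neq x).
have nd k l : (iter k N s == iter l N s') = false.
  by rewrite neq_sides //; [elim: k | elim: l].
have nd' k l : (iter l N s' == iter k N s) = false by rewrite eq_sym nd.
have out : [/\ N s \notin [:: s; s'], N (N s) \notin [:: s; s'],
  N s' \notin [:: s; s'] & N (N s') \notin [:: s; s']].
  by rewrite !inE !n1 !n2 (nd 1 0) (nd 2 0) (nd' 0 1) (nd' 0 2).
have [o1 o2 o3 o4] := out.
have Y0 : Y = set0.
  apply: arcU => c; rewrite inE => /or3P[/andP[nc /imsetP[y Xy def]]||].
  - have [y' g Xy'] := turnX _ Xy.
    have ny : y \notin [:: s; s'] by rewrite -diag -def.
    exists (flip_side s s' y'); first by rewrite def -glued_flip.
    have [[ns ns']|[]] := side_cases y'; last 2 first.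
    + case=> e; rewrite {}e in g Xy' *.
      * move: ny; rewrite glued_sym in g.
        by rewrite (glued_uniq flip_two_sides g gflip) !inE eqxx orbT.
      * by rewrite F1 next_side3 inE eqxx Xy' !orbT.
      * by rewrite F2 -F3 YI // Xs // -[s]next_side3.
    + case=> e; rewrite {}e in g Xy' *.
      * move: ny; rewrite glued_sym in g; move: gflip; rewrite glued_sym => g1.
        by rewrite (glued_uniq flip_two_sides g g1) !inE eqxx.
      * by rewrite F3 next_side3 inE eqxx Xy' !orbT.
      * by rewrite F4 -F1 YI // Xs' // -[s']next_side3.
    + rewrite flip_side_tri // -(flip_side_tri (x := N y')) // YI //.
      by rewrite !inE negb_or; apply/andP; split;
        [move: ns | move: ns']; apply: contra => /eqP<-.
  - case/andP=> /eqP-> XNNs; exists s; first by rewrite glued_sym.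
    by rewrite -F2 YI.
  - case/andP=> /eqP-> XNNs; exists s' => //.
    by rewrite -F4 YI.
have noX c : c \in X -> c \in [:: s; s'].
  by move=> Xc; apply/negPn/negP=> /(YI _ Xc); rewrite Y0 inE.
apply/setP=> c; rewrite inE; apply/negP=> /[dup] Xc /noX.
rewrite !inE => /orP[]/eqP e; rewrite {}e in Xc.
  by move/Xs/noX: Xc; apply/negP.
by move/Xs'/noX: Xc; apply/negP.
Qed.

End Flip.

(** * The quiver of a flipped triangulation *)

(** The gluings obtained by flips are only known to satisfy [two_sides] and
  [unpunctured], so their quiver is defined for any gluing; for a triangulation
  it is convertible to [quiver_of]. *)
Definition gluing_quiver n (T : finType) (arc : T * 'I_3 -> option 'I_n) :
    'M[int]_n :=
  \matrix_(i, j)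
    ((#|[set s | (arc s == Some i) && (arc (next_side s) == Some j)]|)%:Z
     - (#|[set s | (arc s == Some j) && (arc (next_side s) == Some i)]|)%:Z).

Section Quiver.

Variables (n : nat) (T : finType) (arc : T * 'I_3 -> option 'I_n).
Local Notation N := (@next_side T).
Local Notation B := (gluing_quiver arc).
Local Notation chi s i := ((arc s == Some i)%:R : int).
Implicit Types x y : T * 'I_3.

Lemma card_sumZ (P : pred (T * 'I_3)) :
  (#|[set s | P s]|)%:Z = \sum_s ((P s)%:R : int).
Proof.
rewrite cardsE -sum1_card big_mkcond /= -[LHS]natz natr_sum.
by apply: eq_bigr => x _; rewrite unfold_in; case: (P x).
Qed.

Lemma gluing_quiverE i j :
  B i j = \sum_x (chi x i * chi (N x) j - chi x j * chi (N x) i).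
Proof.
rewrite mxE !card_sumZ -sumrB; apply: eq_bigr => x _.
by rewrite -!natrM !mulnb.
Qed.

Lemma gluing_quiver_skew i j : B i j = - B j i.
Proof. by rewrite !mxE opprB. Qed.

Hypothesis arc2 : two_sides arc.

Lemma gluing_quiver_sides s s' i j : glued arc s s' -> arc s = Some i ->
  B i j = chi (N s) j - chi (N (N s)) j + (chi (N s') j - chi (N (N s')) j).
Proof.
move=> g ai; have /and3P[neq _ /eqP ai'] := g; rewrite ai in ai'.
have -> : B i j = \sum_(x | arc x == Some i) (chi (N x) j - chi (N (N x)) j).
  rewrite gluing_quiverE sumrB [X in _ - X](reindex_inj (@next_side_inj T)) /=.
  rewrite [X in _ - X](reindex_inj (@next_side_inj T)) /= -sumrB.
  rewrite [RHS]big_mkcond; apply: eq_bigr => x _ /=.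
  by rewrite next_side3; case: ifP; rewrite ?mul1r ?mulr1 ?mul0r ?mulr0 ?subr0.
rewrite (bigD1 s) ?ai //= (bigD1 s') /= -?ai' ?eqxx 1?eq_sym //.
rewrite big1 ?addr0 // => x /andP[/andP[]].
by rewrite (glued_side arc2 x g ai) => /orP[]/eqP->; rewrite eqxx.
Qed.

End Quiver.

(** In the mutation formula, [p] and [m] count the arrows [i -> k] and
  [k -> i], and [p'] and [m'] the arrows [j -> k] and [k -> j]. As one of [p],
  [m] and one of [p'], [m'] vanish, the formula counts, with signs, the paths
  of length two through [k]. *)
Lemma mutation_term (p m p' m' : nat) : (p * m = 0)%N -> (p' * m' = 0)%N ->
  ((`|p%:Z - m%:Z| * (m'%:Z - p'%:Z) + (p%:Z - m%:Z) * `|m'%:Z - p'%:Z|) %/ 2)%Z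
  = p%:Z * m'%:Z - m%:Z * p'%:Z.
Proof.
move=> pm pm'.
suff -> : `|p%:Z - m%:Z| * (m'%:Z - p'%:Z) + (p%:Z - m%:Z) * `|m'%:Z - p'%:Z| =
    (p%:Z * m'%:Z - m%:Z * p'%:Z) * 2 by rewrite mulzK.
move/eqP: pm; move/eqP: pm'; rewrite -!natz !muln_eq0.
move=> /orP[]/eqP-> /orP[]/eqP->; rewrite ?mulr0n ?subr0 ?sub0r;
  rewrite ?normrN ?normr0 ?normr_nat; ring.
Qed.

Section FlipQuiver.

Variables (n : nat) (T : finType) (arc : T * 'I_3 -> option 'I_n).
Hypotheses (arc2 : two_sides arc) (arcU : unpunctured arc).
Variables (s s' : T * 'I_3) (k : 'I_n).
Hypotheses (gs : glued arc s s') (arc_s : arc s = Some k).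
Local Notation N := (@next_side T).
Local Notation B := (gluing_quiver arc).

(** The sides of the quadrilateral that precede and follow its diagonal [s];
  their arcs have arrows to [k] and from [k] respectively. *)
Definition inflow i : nat :=
  (arc (N (N s)) == Some i) + (arc (N (N s')) == Some i).
Definition outflow i : nat :=
  (arc (N s) == Some i) + (arc (N s') == Some i).

Lemma quiver_diagonal i : B i k = (inflow i)%:Z - (outflow i)%:Z.
Proof.
rewrite gluing_quiver_skew (gluing_quiver_sides arc2 i gs arc_s).
rewrite /inflow /outflow !PoszD -!natz; ring.
Qed.

(** Two neighbouring sides of the quadrilateral never carry the same arc, so no
  arc has arrows both to and from the diagonal before cancellation. *)
Lemma in_outflow i : (inflow i * outflow i = 0)%N.
Proof.
have g' : glued arc s' s by rewrite glued_sym.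
rewrite /inflow /outflow.
case: eqP => a; case: eqP => b; case: eqP => c; case: eqP => d //=; exfalso.
all: try exact: (next_side_arc arcU c a).
all: try exact: (next_side_arc arcU d b).
all: try exact: (consecutive_arcs arcU g' d a).
all: try exact: (consecutive_arcs arcU gs c b).
Qed.

(** Only the triangles of [s] and [s'] contribute to the change of the quiver.
  With [a, b, c, d] the arcs of the quadrilateral in order, starting after [s],
  the arrows [a -> b] and [c -> d] are replaced by [b -> c] and [d -> a], while
  mutation adds the paths from [b] or [d] to [a] or [c] through the diagonal:
  [b -> a] and [d -> c] cancel the old arrows, and [b -> c] and [d -> a] are
  the new ones. *)
Lemma flip_quiver : gluing_quiver (flip arc s s') = mutate_quiver k B.
Proof.
have neq_tri := glued_triangle arcU gs.
have arc_s' : arc s' = Some k by rewrite -(glued_arc gs).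
have [F1 F2 F3 F4 _] := flip_sideE neq_tri.
have [F0 F0'] := flip_side_diag neq_tri.
have gf : glued (flip arc s s') s s' by rewrite glued_flip F0 F0'.
have arcf_s : flip arc s s' s = Some k by rewrite /flip F0.
have rowk j : gluing_quiver (flip arc s s') k j = - B k j.
  rewrite (gluing_quiver_sides (flip_two_sides s s' arc2) j gf arcf_s).
  rewrite (gluing_quiver_sides arc2 j gs arc_s) /flip F1 F2 F3 F4; ring.
apply/matrixP=> i j; rewrite [RHS]mxE.
have [->|nik] := eqVneq i k; first by rewrite rowk.
have [->|njk] := eqVneq j k.
  by rewrite /= gluing_quiver_skew rowk -gluing_quiver_skew.
rewrite /= [B k j]gluing_quiver_skew !quiver_diagonal opprB.
rewrite mutation_term ?in_outflow //.
have split arc' : gluing_quiver arc' i j =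
    \sum_(x | x.1 == s.1) ((arc' x == Some i)%:R * (arc' (N x) == Some j)%:R
      - (arc' x == Some j)%:R * (arc' (N x) == Some i)%:R)
  + \sum_(x | x.1 == s'.1) ((arc' x == Some i)%:R * (arc' (N x) == Some j)%:R
      - (arc' x == Some j)%:R * (arc' (N x) == Some i)%:R)
  + \sum_(x | (x.1 != s.1) && (x.1 != s'.1))
     ((arc' x == Some i)%:R * (arc' (N x) == Some j)%:R
      - (arc' x == Some j)%:R * (arc' (N x) == Some i)%:R).
  rewrite gluing_quiverE (bigID (fun x => x.1 == s.1)) /= -addrA; congr (_ + _).
  rewrite (bigID (fun x => x.1 == s'.1)) /=; congr (_ + _).
  apply: eq_bigl => x; have [->|//] := eqVneq x.1 s.1.
  by rewrite (negPf neq_tri).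
rewrite (split arc) (split (flip arc s s')).
have -> : \sum_(x | (x.1 != s.1) && (x.1 != s'.1))
     ((flip arc s s' x == Some i)%:R * (flip arc s s' (N x) == Some j)%:R
      - (flip arc s s' x == Some j)%:R * (flip arc s s' (N x) == Some i)%:R) =
  \sum_(x | (x.1 != s.1) && (x.1 != s'.1))
     ((arc x == Some i)%:R * (arc (N x) == Some j)%:R
      - (arc x == Some j)%:R * (arc (N x) == Some i)%:R) :> int.
  apply: eq_bigr => x /andP[ns ns'].
  by rewrite /flip !(flip_side_tri neq_tri).
rewrite !sum_triangle !next_side3 /flip F0 F0' F1 F2 F3 F4 arc_s arc_s'.
have ki i0 : i0 != k -> (Some k == Some i0)%:R = 0 :> int.
  by rewrite eq_sym => /negPf neq; rewrite [_ == _]neq.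
rewrite !(ki i) // !(ki j) // /inflow /outflow !PoszD -!natz.
ring.
Qed.

End FlipQuiver.

(** * Dual edges *)

Section PulledBackForm.

Variables (R : realFieldType) (n m : nat).

Definition dot (v w : 'rV[R]_m) : R := (v *m w^T) 0 0.

Lemma dotC v w : dot v w = dot w v.
Proof. by rewrite /dot -[v *m w^T]trmxK trmx_mul trmxK mxE. Qed.

Lemma dotBl v v' w : dot (v - v') w = dot v w - dot v' w.
Proof. by rewrite /dot mulmxBl !mxE. Qed.

Lemma dotBr v w w' : dot v (w - w') = dot v w - dot v w'.
Proof. by rewrite dotC dotBl !(dotC v). Qed.

Lemma dotNN v w : dot (- v) (- w) = dot v w.
Proof. by rewrite /dot mulNmx linearN mulmxN opprK. Qed.

Lemma dotN v w : dot v (- w) = - dot v w.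
Proof. by rewrite /dot linearN mulmxN mxE. Qed.

Lemma dot_ge0 v : 0 <= dot v v.
Proof. by rewrite /dot mxE sumr_ge0 // => i _; rewrite mxE -expr2 sqr_ge0. Qed.

Variable D : 'M[R]_(n, m).

Definition pullback (x y : 'rV[R]_n) : R := dot (x *m D) (y *m D).

Fact pullback_bilinear : bilinear_for
  (GRing.Scale.Law.clone _ _ *%R _) (GRing.Scale.Law.clone _ _ (idfun \; *%R) _)
  pullback.
Proof.
by split=> [z|z] a x y; rewrite /pullback /dot;
  rewrite ?mulmxDl -?scalemxAl ?linearD ?linearZ /= ?mulmxDl ?mulmxDr
    -?scalemxAl -?scalemxAr !mxE.
Qed.

HB.instance Definition _ := bilinear_isBilinear.Build R 'rV[R]_n 'rV[R]_n R
  _ _ pullback pullback_bilinear.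

Fact pullback_hermitian x y :
  pullback x y = (-1) ^+ false * idfun (pullback y x).
Proof. by rewrite mul1r /pullback dotC. Qed.

HB.instance Definition _ := isHermitianSesquilinear.Build R 'rV[R]_n false idfun
  pullback pullback_hermitian.

End PulledBackForm.

Section DualEdges.

Variables (R : realFieldType) (n : nat) (T : finType).
Local Notation N := (@next_side T).
Implicit Types (arc : T * 'I_3 -> option 'I_n) (x y : T * 'I_3).

Definition tri_vec (t : T) : 'rV[R]_#|T| := delta_mx 0 (enum_rank t).

Lemma dot_tri_vec t t' : dot (tri_vec t) (tri_vec t') = (t == t')%:R.
Proof.
rewrite /dot /tri_vec trmx_delta mul_delta_mx_cond (inj_eq enum_rank_inj).
by rewrite mulmxnE mxE !eqxx.
Qed.

Definition dual_edges arc (w : 'I_n -> 'rV[R]_#|T|) :=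
  forall i x y, glued arc x y -> arc x = Some i ->
  w i = tri_vec x.1 - tri_vec y.1 \/ w i = tri_vec y.1 - tri_vec x.1.

Lemma dual_edges_exist arc : two_sides arc ->
  exists w : 'I_n -> 'rV[R]_#|T|, dual_edges arc w.
Proof.
move=> arc2.
have [w wP] : exists w : 'I_n -> 'rV[R]_#|T|, forall i,
    exists x y, [/\ glued arc x y, arc x = Some i
                  & w i = tri_vec x.1 - tri_vec y.1].
  apply: (@fin_all_exists _ _ (fun i w => exists x y,
    [/\ glued arc x y, arc x = Some i & w = tri_vec x.1 - tri_vec y.1])) => i.
  have [x [y [g ax _]]] := arc_sides arc2 i.
  by exists (tri_vec x.1 - tri_vec y.1), x, y.
exists w => i x' y' g' ax'; have [x [y [g ax ->]]] := wP i.
have := glued_side arc2 x' g ax; rewrite ax' eqxx => /esym/orP[]/eqP def.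
  by left; rewrite def; rewrite def in g'; rewrite (glued_uniq arc2 g g').
right; rewrite def; rewrite def in g'; rewrite glued_sym in g.
by rewrite (glued_uniq arc2 g g').
Qed.

(** The counting behind the comparison of the dot product with the quiver: for
  an arc with sides [x, x'] and another one with sides [y, y'], the letters
  [p], [q] say that [y], [y'] comes after [x] in its triangle, immediately
  (index 1) or not (index 2), and [r], [s] say the same of [y], [y'] and [x'].
  The hypotheses say that no triangle contains an arc twice and that arrows do
  not cancel. *)
Lemma corner_count (p1 p2 q1 q2 r1 r2 s1 s2 : bool) :
  ~~ (p1 && p2) -> ~~ (q1 && q2) -> ~~ (r1 && r2) -> ~~ (s1 && s2) ->
  ~~ ((p1 || p2) && (q1 || q2)) -> ~~ ((r1 || r2) && (s1 || s2)) ->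
  ~~ ((p1 || p2) && (r1 || r2)) -> ~~ ((q1 || q2) && (s1 || s2)) ->
  ~~ (p1 && s2) -> ~~ (p2 && s1) -> ~~ (q1 && r2) -> ~~ (q2 && r1) ->
  `|(p1 || p2)%:R - (q1 || q2)%:R - ((r1 || r2)%:R - (s1 || s2)%:R) : int| =
  `|(p1 || q1)%:R - (p2 || q2)%:R + ((r1 || s1)%:R - (r2 || s2)%:R)|.
Proof.
by case: p1 p2 q1 q2 => [] [] [] []; case: r1 r2 s1 s2 => [] [] [] [].
Qed.

Lemma dot_dual_edges arc w i j : two_sides arc -> unpunctured arc ->
  dual_edges arc w -> i != j ->
  `|dot (w i) (w j)| = `|gluing_quiver arc i j|%:~R.
Proof.
move=> arc2 arcU wP neq_ij.
have [x [x' [gx ax ax']]] := arc_sides arc2 i.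
have [y [y' [gy ay ay']]] := arc_sides arc2 j.
have gx' : glued arc x' x by rewrite glued_sym.
have gy' : glued arc y' y by rewrite glued_sym.
have -> : `|dot (w i) (w j)| =
    `|dot (tri_vec x.1 - tri_vec x'.1) (tri_vec y.1 - tri_vec y'.1)|.
  have flipN (a b : T) : tri_vec a - tri_vec b = - (tri_vec b - tri_vec a).
    by rewrite opprB.
  have [->|->] := wP _ _ _ gx ax; have [->|->] := wP _ _ _ gy ay => //.
  - by rewrite (flipN y'.1) dotN normrN.
  - by rewrite (flipN x'.1) dotC dotN normrN dotC.
  - by rewrite (flipN x'.1) (flipN y'.1) dotNN.
rewrite (gluing_quiver_sides arc2 j gx ax) !(glued_side arc2 _ gy ay).
have neq z z' : arc z = Some i -> arc z' = Some j -> (z' == z) = false.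
  move=> az az'; apply: contraNF neq_ij => /eqP def.
  by rewrite def az in az'; case: az' => ->.
rewrite dotBl !dotBr !dot_tri_vec !same_triangleP.
rewrite !(neq x) // !(neq x') //= ![N _ == _]eq_sym.
have tri z z' : (z' == N z) || (z' == N (N z)) -> z.1 = z'.1.
  by move=> H; apply/eqP; rewrite same_triangleP H orbT.
have once z z' : ~~ ((z' == N z) && (z' == N (N z))).
  apply/andP=> -[/eqP-> /eqP/next_side_inj/esym/eqP].
  by rewrite (negPf (next_side_neq z)).
have not_both z u u' : glued arc u u' ->
    ~~ (((u == N z) || (u == N (N z))) && ((u' == N z) || (u' == N (N z)))).
  move=> g; apply/andP=> -[/tri e /tri e'].
  by move: (glued_triangle arcU g); rewrite -e -e' eqxx.
have not_both' u z z' : glued arc z z' ->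
    ~~ (((u == N z) || (u == N (N z))) && ((u == N z') || (u == N (N z')))).
  move=> g; apply/andP=> -[/tri e /tri e'].
  by move: (glued_triangle arcU g); rewrite e e' eqxx.
have no_cancel z z' u u' : glued arc z z' ->
    arc u = Some j -> arc u' = Some j ->
    ~~ ((u == N z) && (u' == N (N z'))).
  move=> g au au'; apply/andP=> -[/eqP eu /eqP eu'].
  by apply: (consecutive_arcs arcU g (i := j)); rewrite -?eu -?eu'.
rewrite -corner_count ?once ?not_both ?not_both' //; try exact: no_cancel.
all: try by rewrite andbC; apply: no_cancel.
by rewrite intr_norm !rmorphB /= !rmorph_nat.
Qed.

End DualEdges.

(** * Reflections and flips *)

Section FlipVectors.

Variables (R : realFieldType) (n : nat) (T : finType).
Local Notation N := (@next_side T).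
Local Notation e := (@tri_vec R T).

(** The vector [a] has square norm 2, and the reflection in [e t - e t'] is the
  transposition of these two basis vectors. *)
Lemma reflect_tri_vec (a : 'rV[R]_#|T|) t t' u :
  a = e t - e t' \/ a = e t' - e t -> t != t' ->
  e u - dot (e u) a *: a = e (if u == t then t' else if u == t' then t else u).
Proof.
move=> aE neq.
have -> : dot (e u) a *: a = dot (e u) (e t - e t') *: (e t - e t').
  case: aE => -> //; rewrite -(opprB (e t) (e t')) dotN.
  by rewrite scaleNr scalerN opprK.
rewrite dotBr !dot_tri_vec.
have [->|_] := eqVneq u t; first by rewrite (negPf neq) subr0 scale1r subKr.
have [->|_] := eqVneq u t'.
  by rewrite sub0r scaleN1r opprK addrC subrK.
by rewrite subr0 scale0r subr0.
Qed.

(** The mutation of vectors, read on their images in the span of the [e_t]. *)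
Definition mutate_edges (k : 'I_n) (B : 'M[int]_n)
    (w : 'I_n -> 'rV[R]_#|T|) (i : 'I_n) : 'rV[R]_#|T| :=
  if i == k then - w k
  else if 0 < B i k then w i - dot (w i) (w k) *: w k else w i.

(** An arc with an arrow to the diagonal has all its sides on [N (N s)] and
  [N (N s')] or outside the quadrilateral, so on the triangles of its sides the
  flip acts as the exchange of the two triangles, like the reflection. An arc
  with an arrow from the diagonal has none on these two sides, and neither the
  flip nor the mutation changes its triangles or its vector. *)
Lemma flip_dual_edges (arc : T * 'I_3 -> option 'I_n) w s s' k :
  two_sides arc -> unpunctured arc -> glued arc s s' -> arc s = Some k ->
  dual_edges arc w ->
  dual_edges (flip arc s s') (mutate_edges k (gluing_quiver arc) w).
Proof.
move=> arc2 arcU gs arc_s wP i x y; rewrite glued_flip /flip => gxy arc_x.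
have neq_tri := glued_triangle arcU gs.
have arc_s' : arc s' = Some k by rewrite -(glued_arc gs).
have [F1 F2 F3 F4 _] := flip_sideE neq_tri.
have [F0 F0'] := flip_side_diag neq_tri.
rewrite /mutate_edges; have [def_i|neq_ik] := eqVneq i k.
  have on_diag z : arc (flip_side s s' z) = Some k -> flip_side s s' z = z.
    move/eqP; rewrite (glued_side arc2 _ gs arc_s).
    by case/orP=> /eqP def; apply: (@perm_inj _ (flip_side s s')); rewrite def.
  rewrite def_i in arc_x.
  have arc_y := glued_arc gxy; rewrite arc_x in arc_y.
  have [fx fy] := (on_diag _ arc_x, on_diag _ (esym arc_y)).
  move: gxy arc_x; rewrite fx fy => g ax.
  by have [->|->] := wP _ _ _ g ax; rewrite opprB; [right|left].
have arc_y := glued_arc gxy; rewrite arc_x in arc_y.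
pose refl v := v - dot v (w k) *: w k.
have reflE : forall u,
    refl (e u) = e (if u == s.1 then s'.1 else if u == s'.1 then s.1 else u).
  by move=> u; apply: reflect_tri_vec (wP _ _ _ gs arc_s) neq_tri.
pose move_tri v := if 0 < gluing_quiver arc i k then refl v else v.
have moveE z : arc (flip_side s s' z) = Some i ->
    e z.1 = move_tri (e (flip_side s s' z).1).
  move=> az; have := in_outflow arcU gs i.
  rewrite /move_tri (quiver_diagonal arc2 gs arc_s) subr_gt0 ltz_nat !reflE.
  have [[ns ns']|[]] := side_cases s s' z.
  - by rewrite flip_side_tri // (negPf ns) (negPf ns') if_same.
  - case=> def; rewrite {}def in az *.
    + by move: az; rewrite F0 arc_s => -[ek]; rewrite ek eqxx in neq_ik.
    + rewrite F1 in az *; rewrite /inflow az eqxx addn1 mulSn.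
      move/eqP; rewrite addn_eq0 => /andP[/eqP-> _] /=.
      by rewrite eq_sym (negPf neq_tri) eqxx.
    + rewrite F2 in az *; rewrite /outflow az eqxx add1n mulnS.
      by move/eqP; rewrite addn_eq0 => /andP[/eqP-> _].
  - case=> def; rewrite {}def in az *.
    + by move: az; rewrite F0' arc_s' => -[ek]; rewrite ek eqxx in neq_ik.
    + rewrite F3 in az *; rewrite /inflow az eqxx add1n mulSn.
      by move/eqP; rewrite addn_eq0 => /andP[/eqP-> _] /=; rewrite eqxx.
    + rewrite F4 in az *; rewrite /outflow az eqxx addn1 mulnS.
      by move/eqP; rewrite addn_eq0 => /andP[/eqP-> _].
have moveB v v' : move_tri (v - v') = move_tri v - move_tri v'.
  rewrite /move_tri; case: ifP => // _.
  by rewrite /refl dotBl scalerBl !opprD !opprK addrACA.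
rewrite (moveE x) // (moveE y) // -!moveB -/(refl (w i)) -/(move_tri (w i)).
by have [->|->] := wP _ _ _ gxy arc_x; [left|right].
Qed.

End FlipVectors.

(** * Mutation of companion bases *)

Section Companions.

Variables (R : realFieldType) (n : nat) (T : finType).
Variable D : 'M[R]_(n, #|T|).

Definition dual_edge (u : n.-tuple 'rV[R]_n) (i : 'I_n) : 'rV[R]_#|T| :=
  tnth u i *m D.

(** The invariant of mutation. The gluing changes under flips, but it is always
  one of the same set of triangles, so a single matrix [D] serves for all. *)
Definition surface_state (p : 'M[int]_n * n.-tuple 'rV[R]_n) : Prop :=
  exists arc : T * 'I_3 -> option 'I_n,
    [/\ two_sides arc, unpunctured arc, p.1 = gluing_quiver arc
      & dual_edges arc (dual_edge p.2)].

Lemma dual_edges_eq (arc : T * 'I_3 -> option 'I_n)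
    (w w' : 'I_n -> 'rV[R]_#|T|) :
  w =1 w' -> dual_edges arc w -> dual_edges arc w'.
Proof. by move=> ww wP i x y g ax; rewrite -ww; apply: wP. Qed.

Lemma mutate_surface_state p k :
  surface_state p -> surface_state (mutate_pair (pullback D) p k).
Proof.
case: p => B u [arc [/= arc2 arcU -> wP]].
have [s [s' [gs arc_s _]]] := arc_sides arc2 k.
exists (flip arc s s'); split=> /=.
- exact: flip_two_sides.
- by apply: flip_unpunctured => //; apply: glued_triangle gs.
- by rewrite (flip_quiver arc2 arcU gs arc_s).
apply: dual_edges_eq (flip_dual_edges arc2 arcU gs arc_s wP) => i.
rewrite /mutate_edges /dual_edge tnth_mktuple; case: ifP => _.
  by rewrite mulNmx.
by case: ifP => // _; rewrite mulmxBl -scalemxAl.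
Qed.

Lemma surface_state_companion p : surface_state p ->
  quasi_Cartan_companion p.1 (gram (pullback D) p.2).
Proof.
case: p => B u [arc [/= arc2 arcU -> wP]]; split.
- by apply/matrixP=> i j; rewrite [LHS]mxE [LHS]mxE [RHS]mxE; apply: dotC.
- move=> i; rewrite mxE.
  have [x [y [g ax _]]] := arc_sides arc2 i.
  have neq := negPf (glued_triangle arcU g).
  rewrite -[LHS]/(dot (dual_edge u i) (dual_edge u i)).
  by have [->|->] := wP _ _ _ g ax; rewrite dotBl !dotBr !dot_tri_vec !eqxx
    1?[y.1 == x.1]eq_sym neq subr0 sub0r opprK.
by move=> i j neq; rewrite mxE; apply: (dot_dual_edges arc2 arcU wP neq).
Qed.

Lemma gram_pos_semidef (u : n.-tuple 'rV[R]_n) :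
  pos_semidef (gram (pullback D) u).
Proof.
move=> x; pose W := \matrix_i dual_edge u i.
have -> : gram (pullback D) u = W *m W^T.
  apply/matrixP=> i j; rewrite mxE.
  rewrite -[LHS]/((dual_edge u i *m (dual_edge u j)^T) 0 0) [LHS]mxE [RHS]mxE.
  by apply: eq_bigr => l _; rewrite ![(_ ^T) _ _]mxE !(mxE _ (fun _ _ => _)).
rewrite -mulmxA -mulmxA -trmx_mul mulmxA; exact: dot_ge0.
Qed.

End Companions.

Theorem theorem5p5 (R : realType) (n : nat) (T : triangulation n) :
  exists (V : vectType R) (form : {symmetric V}%R) (u : n.-tuple V),
    companion_basis form (quiver_of T) u /\
    forall ks : seq 'I_n,
      let p := mutate_seq form ks (quiver_of T, u) in
      quasi_Cartan_companion p.1 (gram form p.2) /\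
      pos_semidef (gram form p.2).
Proof.
have arc2 := @arc_two_sides n T.
have [w wP] := dual_edges_exist R arc2.
pose D := \matrix_i w i.
pose u := [tuple delta_mx 0 i : 'rV[R]_n | i < n].
have init : surface_state D (quiver_of T, u).
  exists (@arc_of n T); split=> //.
  - exact: triangulation_unpunctured.
  - apply: dual_edges_eq wP => i.
    by rewrite /dual_edge tnth_mktuple -rowE rowK.
exists ('rV[R]_n : vectType R), (pullback D), u; split.
  split; last exact: surface_state_companion init.
  rewrite basisEdim dimvf dim_matrix mul1r size_tuple leqnn andbT.
  apply/subvP=> v _; rewrite [v]row_sum_delta; apply: memv_suml => i _.
  by rewrite memvZ // memv_span //; apply/tnthP; exists i; rewrite tnth_mktuple.
move=> ks p; split; last exact: gram_pos_semidef.
apply: surface_state_companion; rewrite /p.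
elim: ks (quiver_of T, u) init {p} => //= k ks IHks p Sp.
by apply: IHks; apply: mutate_surface_state.
Qed.
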